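(* Let $(A,\mu_0)$ be a left alternative algebra over $\mathbb{K}$ and let $\alpha_t$ be an algebra endomorphism of $(A,\mu_0)$ of the form $\alpha_t=\mathrm{id}+\sum_{i=1}^{p}t^i\alpha_i$, where the $\alpha_i$ are linear maps on $A$, $t$ is a parameter in $\mathbb{K}$ and $p$ is an integer. Set $\mu_t=\alpha_t\circ\mu_0$. Then $(A,\mu_t,\alpha_t)$ is a left Hom-alternative algebra which is a deformation of the left alternative algebra viewed as the Hom-alternative algebra $(A,\mu_0,\mathrm{id})$. Moreover, for every $n\ge 0$, the $n$th derived Hom-algebra of type 1, $$A_t^n=\left(A,\ \mu_t^{(n)}=\alpha_t^{n}\circ\mu_t,\ \alpha_t^{n+1}\right),$$ is a deformation of $(A,\mu_0,\mathrm{id})$.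
   Context: $\mathbb{K}$ is an algebraically closed field of characteristic zero. A left Hom-alternative algebra is a triple $(A,\mu,\alpha)$ consisting of a $\mathbb{K}$-vector space $A$, a bilinear map $\mu:A\times A\to A$ and a linear map $\alpha:A\to A$ such that $\mu(\alpha(x),\mu(x,y))=\mu(\mu(x,x),\alpha(y))$ for all $x,y\in A$. A left alternative algebra $(A,\mu_0)$ is the case $\alpha=\mathrm{id}$: $\mu_0(x,\mu_0(x,y))=\mu_0(\mu_0(x,x),y)$; it is viewed as the left Hom-alternative algebra $(A,\mu_0,\mathrm{id})$. That $\alpha_t$ is an algebra endomorphism means $\alpha_t(\mu_0(x,y))=\mu_0(\alpha_t(x),\alpha_t(y))$ for all $x,y\in A$, as an identity in the parameter $t$. Powers of $\alpha_t$ denote iterated composition. A (formal left Hom-alternative) deformation of a left Hom-alternative algebra $(A,\mu_0,\alpha_0)$ is given by a $\mathbb{K}[[t]]$-bilinear map $\mu_t=\sum_{i\ge0}\mu_i t^i$ and a $\mathbb{K}[[t]]$-linear map $\alpha_t=\sum_{i\ge0}\alpha_i t^i$ on $A[[t]]$, where each $\mu_i:A\times A\to A$ is $\mathbb{K}$-bilinear and each $\alpha_i:A\to A$ is $\mathbb{K}$-linear (extended over $\mathbb{K}[[t]]$), whose degree-zero terms are the given $\mu_0$ and $\alpha_0$, such that for all $x,y,z\in A$ $$\mu_t(\alpha_t(x),\mu_t(y,z))-\mu_t(\mu_t(x,y),\alpha_t(z))+\mu_t(\alpha_t(y),\mu_t(x,z))-\mu_t(\mu_t(y,x),\alpha_t(z))=0.$$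 *)

(* Defs.v *)
From HB Require Import structures.
From mathcomp Require Import all_boot all_order all_algebra.
From mathcomp Require Import sesquilinear.

Set Implicit Arguments.
Unset Strict Implicit.
Unset Printing Implicit Defensive.

Import GRing.Theory.
Local Open Scope ring_scope.

Definition left_hom_alternative (K : fieldType) (A : lmodType K)
    (mu : A -> A -> A) (alpha : A -> A) : Prop :=
  [/\ bilinear_for *:%R *:%R mu,
      linear alpha
    & forall x y : A, mu (alpha x) (mu x y) = mu (mu x x) (alpha y)].

Definition left_alternative (K : fieldType) (A : lmodType K)
    (mu : A -> A -> A) : Prop :=
  bilinear_for *:%R *:%R mu /\
  forall x y : A, mu x (mu x y) = mu (mu x x) y.

(* Derived Hom-algebra of type 1.  The carrier T is either A or A[[t]]. *)
Definition derived_mul (T : Type) (n : nat) (mu : T -> T -> T)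
    (alpha : T -> T) : T -> T -> T :=
  fun x y => iter n alpha (mu x y).

Definition derived_twist (T : Type) (n : nat) (alpha : T -> T) : T -> T :=
  iter n.+1 alpha.

(* A[[t]]: X n is the coefficient of t^n; series are compared coefficientwise,
   i.e. up to =1. *)
Definition fps (A : Type) : Type := nat -> A.

Definition fps_const (A : nmodType) (x : A) : fps A :=
  fun n => if n == 0%N then x else 0.

(* The K[[t]]-linear extension of \sum_i f_i t^i to A[[t]]. *)
Definition fps_lin (A : nmodType) (f : nat -> A -> A) (X : fps A) : fps A :=
  fun n => \sum_(i < n.+1) f i (X (n - i)%N).

(* The K[[t]]-bilinear extension of \sum_i mu_i t^i to A[[t]]: the coefficient
   of t^n is the sum of mu_i (X_j, Y_k) over i + j + k = n. *)
Definition fps_bilin (A : nmodType) (mu : nat -> A -> A -> A)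
    (X Y : fps A) : fps A :=
  fun n => \sum_(i < n.+1) \sum_(j < (n - i).+1)
             mu i (X j) (Y (n - i - j)%N).

Definition fps_mul0 (A : nmodType) (mu0 : A -> A -> A) :
    fps A -> fps A -> fps A :=
  fps_bilin (fun i => if i == 0%N then mu0 else fun _ _ => 0).

Definition is_deformation (K : fieldType) (A : lmodType K)
    (mu0 : A -> A -> A) (alpha0 : A -> A)
    (mut : fps A -> fps A -> fps A) (alphat : fps A -> fps A) : Prop :=
  left_hom_alternative mu0 alpha0 /\
  exists (mu : nat -> A -> A -> A) (alpha : nat -> A -> A),
    [/\ (forall i, bilinear_for *:%R *:%R (mu i)) /\
        (forall i, linear (alpha i)),
        (forall X Y, mut X Y =1 fps_bilin mu X Y) /\
        (forall X, alphat X =1 fps_lin alpha X),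
        mu 0%N =2 mu0,
        alpha 0%N =1 alpha0
      & forall (a b c : A) (n : nat),
          let x := fps_const a in
          let y := fps_const b in
          let z := fps_const c in
            mut (alphat x) (mut y z) n - mut (mut x y) (alphat z) n
          + mut (alphat y) (mut x z) n - mut (mut y x) (alphat z) n = 0].

(* id + \sum_(1 <= i <= p) t^i alpha_i, first evaluated at a scalar t and then
   as a K[[t]]-linear map on A[[t]].  Values alpha i with i = 0 or i > p are
   not used. *)
Definition alpha_at (K : fieldType) (A : lmodType K) (p : nat)
    (alpha : nat -> A -> A) (t : K) : A -> A :=
  fun x => x + \sum_(1 <= i < p.+1) t ^+ i *: alpha i x.

Definition alpha_coef (A : nmodType) (p : nat) (alpha : nat -> A -> A) :
    nat -> A -> A :=
  fun i x => if i == 0%N then x else if (i <= p)%N then alpha i x else 0.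

Definition alpha_fps (A : nmodType) (p : nat) (alpha : nat -> A -> A) :
    fps A -> fps A :=
  fps_lin (alpha_coef p alpha).

(* Main.v *)
Require Import Defs.
From HB Require Import structures.
From mathcomp Require Import all_boot all_order all_algebra.
From mathcomp Require Import sesquilinear.

Set Implicit Arguments.
Unset Strict Implicit.
Unset Printing Implicit Defensive.

Import GRing.Theory.
Local Open Scope ring_scope.

(** Everything rests on the fact that a multiplicative twist [G] is compatible
    with itself: if [G (x * y) = G x * G y] and the product is replaced by
    [x . y = G (x * y)], then [G x . (y . z) = G (G (x * (y * z)))] and
    [(x . y) . G z = G (G ((x * y) * z))].  The Hom-alternative identity of the
    twisted product is therefore [G \o G] applied to the (linearized) left
    alternative identity of the original one
    ([left_alternative_linearized], [twist_is_deformation]).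

    Over [A[[t]]] the twist is an iterate of [alphat].  Multiplicativity passes
    to iterates, so only that of [alphat] itself needs an argument.  The
    hypothesis gives it for scalar values of [t]; both sides are polynomials
    in [t] with coefficients in [A] which agree on an infinite field, hence they
    have the same coefficients ([vanishing_poly_coef], [endo_coef]).  These
    coefficient identities, summed over four indices of fixed total degree, say
    that [alphat] is multiplicative on series ([antidiag_interchange],
    [fps_lin_mul]).  Iterates of [alphat] are again series of linear maps with
    constant term the identity ([iter_fps_lin]), so that each derived algebra
    starts at [(A, mu0, id)]; the algebra with twist [alphat] itself is the
    derived algebra for [n = 0]. *)

(** * Sums over antidiagonals *)

Section Antidiagonal.
Context {V : nmodType}.
Implicit Types (n : nat) (F G : nat -> nat -> V).

Definition antidiag n F : V := \sum_(i < n.+1) F i (n - i)%N.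

Lemma eq_antidiag n F G : F =2 G -> antidiag n F = antidiag n G.
Proof. by move=> eqFG; apply: eq_bigr => i _; apply: eqFG. Qed.

Lemma antidiagC n F : antidiag n F = antidiag n (fun i j => F j i).
Proof.
rewrite /antidiag (reindex_inj rev_ord_inj); apply: eq_bigr => i _.
by rewrite /= !subSS subKn // -ltnS.
Qed.

(** The antidiagonals below [N] cut the triangle [i + j < N] into slices. *)
Lemma sum_antidiag N F :
  \sum_(k < N) antidiag k F = \sum_(i < N) \sum_(j < N - i) F i j.
Proof.
elim: N => [|N IHN]; first by rewrite !big_ord0.
rewrite big_ord_recr IHN [RHS]big_ord_recr /= subSnn big_ord1.
rewrite /antidiag big_ord_recr /= subnn addrA; congr (_ + _).
rewrite -big_split; apply: eq_bigr => i _ /=.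
by rewrite subSn ?(ltnW (ltn_ord i)) // big_ord_recr.
Qed.

(** Both sides are the sum of [F i j l] over [i + j + l = n]. *)
Lemma antidiagA n (F : nat -> nat -> nat -> V) :
  antidiag n (fun i m => antidiag m (F i)) =
  antidiag n (fun m l => antidiag m (fun i j => F i j l)).
Proof.
pose G i j := F i j (n - i - j)%N.
transitivity (\sum_(i < n.+1) \sum_(j < n.+1 - i) G i j).
  by apply: eq_bigr => i _; rewrite subSn // -ltnS.
rewrite -sum_antidiag; apply: eq_bigr => k _; apply: eq_bigr => i _.
by rewrite /G -subnDA subnKC // -ltnS.
Qed.

Lemma exchange_antidiag m n (F : nat -> nat -> nat -> nat -> V) :
  antidiag m (fun i j => antidiag n (F i j)) =
  antidiag n (fun k l => antidiag m (fun i j => F i j k l)).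
Proof. exact: exchange_big. Qed.

(** The four indices on each side are those with [a + b + j + k = n]; on the
    left they are grouped as in [f (X * Y)] and on the right as in
    [f X * f Y]. *)
Lemma antidiag_interchange n (H : nat -> nat -> nat -> nat -> V) :
  antidiag n (fun i m =>
    antidiag m (fun j k => antidiag i (fun a b => H a b j k))) =
  antidiag n (fun m m' =>
    antidiag m (fun a j => antidiag m' (fun b k => H a b j k))).
Proof.
rewrite antidiagA.
under eq_antidiag => m k.
  rewrite -(antidiagA m (fun a b j => H a b j k)).
  under eq_antidiag => a q do rewrite antidiagC.
  rewrite antidiagA.
  over.
rewrite -(antidiagA n (fun q b k => antidiag q (fun a j => H a b j k))).
by apply: eq_antidiag => q r; rewrite exchange_antidiag.
Qed.

(** Multiplying two polynomials: [F i j] is the product of the terms of degrees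
    [i] and [j], which vanishes beyond the degree [p] of the factors. *)
Lemma sum_antidiag_square p F :
    (forall i j, (p < i)%N || (p < j)%N -> F i j = 0) ->
  \sum_(k < (p + p).+1) antidiag k F =
  \sum_(i < p.+1) \sum_(j < p.+1) F i j.
Proof.
move=> F0; rewrite sum_antidiag -addSn big_split_ord /=.
rewrite [X in _ + X]big1 ?addr0 => [|i _]; last first.
  by apply: big1 => j _; rewrite F0 ?ltn_addr.
apply: eq_bigr => i _; rewrite -addnBAC; last by rewrite ltnW.
have le_p : (p.+1 <= p.+1 - i + p)%N.
  by rewrite subSn ?addSn ?ltnS ?leq_addl // -ltnS.
rewrite -(subnKC le_p) big_split_ord /=.
rewrite [X in _ + X]big1 ?addr0 // => j _.
by rewrite F0 // ltn_addr ?orbT.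
Qed.

End Antidiagonal.

(** * Linear maps given by the unbundled predicate *)

(** The maps of a deformation are linear by a proposition, not by their type,
    and the lemmas on morphisms apply to them only after bundling. *)
Lemma linear_raddf (K : fieldType) (A B : lmodType K) (f : A -> B) :
    linear f ->
  [/\ f 0 = 0, {morph f : x y / x + y}, {morph f : x y / x - y},
      forall a, {morph f : x / a *: x}
    & forall n (F : 'I_n -> A), f (\sum_(i < n) F i) = \sum_(i < n) f (F i)].
Proof.
move=> lin_f.
pose g : {linear A -> B} := HB.pack f (GRing.isLinear.Build K A B *:%R f lin_f).
split=> [|x y|x y|a x|n F].
- exact: (raddf0 g).
- exact: (raddfD g).
- exact: (raddfB g).
- exact: (linearZ_LR g).
- exact: (raddf_sum g).
Qed.

Lemma linear_antidiag (K : fieldType) (A B : lmodType K) (f : A -> B) n F :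
  linear f -> f (antidiag n F) = antidiag n (fun i j => f (F i j)).
Proof. by case/linear_raddf=> _ _ _ _ ->. Qed.

Lemma antidiag_linear (K : fieldType) (A B : lmodType K) n
    (F : nat -> nat -> A -> B) :
    (forall i j, linear (F i j)) ->
  linear (fun x => antidiag n (fun i j => F i j x)).
Proof.
move=> linF a x y; rewrite /antidiag scaler_sumr -big_split.
by apply: eq_bigr => i _; apply: linF.
Qed.

(** * Polynomials with vector coefficients *)

(** The rows of the inverse of the Vandermonde matrix of the points combine the
    values of the polynomial into its coefficients. *)
Lemma vanishing_poly_coef (K : fieldType) (A : lmodType K) N (a : 'I_N -> K)
    (c : nat -> A) :
    injective a -> (forall k, \sum_(i < N) a k ^+ i *: c i = 0) ->
  forall i, (i < N)%N -> c i = 0.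
Proof.
move=> inj_a c_vanish j lt_jN.
pose W := Vandermonde N (\row_k a k).
have unitW : W \in unitmx.
  rewrite unitmxE det_Vandermonde unitfE.
  apply/prodf_neq0 => k _; apply/prodf_neq0 => l lt_kl.
  rewrite !mxE subr_eq0 (inj_eq inj_a).
  by apply: contraTneq lt_kl => ->; rewrite ltnn.
pose j0 := Ordinal lt_jN; pose w k : K := invmx W k j0.
have w_dual (i : 'I_N) : \sum_k w k * a k ^+ i = (i == j0)%:R.
  have /matrixP/(_ i j0) := mulmxV unitW; rewrite !mxE => <-.
  by apply: eq_bigr => k _; rewrite !mxE mulrC.
have -> : c j = \sum_k w k *: \sum_(i < N) a k ^+ i *: c i.
  under eq_bigr => k _ do rewrite scaler_sumr.
  rewrite exchange_big (bigD1 j0) //= [X in _ + X]big1 => [|i /negPf ne_ij].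
    under eq_bigr => k _ do rewrite scalerA.
    by rewrite -scaler_suml (w_dual j0) eqxx scale1r addr0.
  under eq_bigr => k _ do rewrite scalerA.
  by rewrite -scaler_suml w_dual ne_ij scale0r.
by apply: big1 => k _; rewrite c_vanish scaler0.
Qed.

(** * Formal series of linear maps *)

Section Series.
Variables (K : fieldType) (A : lmodType K).
Implicit Types (f g : nat -> A -> A) (X Y : fps A) (mu : A -> A -> A).

Lemma fps_linE f X n : fps_lin f X n = antidiag n (fun i j => f i (X j)).
Proof. by []. Qed.

Lemma eq_fps_lin f X Y : X =1 Y -> fps_lin f X =1 fps_lin f Y.
Proof. by move=> eqXY n; apply: eq_bigr => i _; rewrite eqXY. Qed.

(** A series of products reduced to its constant term leaves the ordinary Cauchy
    product of the two arguments. *)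
Lemma fps_mul0E mu X Y n :
  fps_mul0 mu X Y n = antidiag n (fun i j => mu (X i) (Y j)).
Proof.
rewrite /fps_mul0 /fps_bilin big_ord_recl /= subn0 [X in _ + X]big1 ?addr0 //.
by move=> i _; apply: big1.
Qed.

Lemma eq_fps_mul0 mu X X' Y Y' :
  X =1 X' -> Y =1 Y' -> fps_mul0 mu X Y =1 fps_mul0 mu X' Y'.
Proof.
move=> eqX eqY n; rewrite !fps_mul0E.
by apply: eq_antidiag => i j; rewrite eqX eqY.
Qed.

Lemma fps_lin_const f x n :
  (forall i, linear (f i)) -> fps_lin f (fps_const x) n = f n x.
Proof.
move=> lin_f; rewrite /fps_lin big_ord_recr /= subnn /fps_const eqxx.
rewrite big1 ?add0r // => i _; rewrite subn_eq0 leqNgt ltn_ord /=.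
by case/linear_raddf: (lin_f i).
Qed.

Lemma fps_mul0_const mu a b :
    bilinear_for *:%R *:%R mu ->
  fps_mul0 mu (fps_const a) (fps_const b) =1 fps_const (mu a b).
Proof.
case=> linl linr n; rewrite fps_mul0E /antidiag big_ord_recl subn0.
rewrite [X in _ + X]big1 ?addr0 => [|i _].
  rewrite /fps_const eqxx; case: (n == 0%N) => //.
  by case/linear_raddf: (linr a).
by case/linear_raddf: (linl (fps_const b (n - lift ord0 i)%N)).
Qed.

(** The Cauchy product of two series of maps, multiplied by composition. *)
Definition comp_coef f g : nat -> A -> A :=
  fun n x => antidiag n (fun i j => f i (g j x)).

Lemma comp_coef_linear f g :
    (forall i, linear (f i)) -> (forall i, linear (g i)) ->
  forall n, linear (comp_coef f g n).
Proof.
move=> lin_f lin_g n; apply: antidiag_linear => i j c x y.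
by rewrite lin_g lin_f.
Qed.

Lemma fps_lin_comp f g X :
    (forall i, linear (f i)) ->
  fps_lin f (fps_lin g X) =1 fps_lin (comp_coef f g) X.
Proof.
move=> lin_f n; rewrite !fps_linE -antidiagA.
by apply: eq_antidiag => i j; rewrite fps_linE linear_antidiag.
Qed.

(** The coefficient identities assumed on [f] are multiplicativity on constants;
    the extension to all series is a regrouping of indices. *)
Lemma fps_lin_mul mu f :
    bilinear_for *:%R *:%R mu -> (forall i, linear (f i)) ->
    (forall n x y, f n (mu x y) =
       antidiag n (fun i j => mu (f i x) (f j y))) ->
  forall X Y, fps_lin f (fps_mul0 mu X Y) =1
              fps_mul0 mu (fps_lin f X) (fps_lin f Y).
Proof.
move=> [linl linr] lin_f f_mu X Y n.
pose H a b j k := mu (f a (X j)) (f b (Y k)).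
transitivity (antidiag n (fun i m =>
    antidiag m (fun j k => antidiag i (fun a b => H a b j k)))).
  rewrite fps_linE; apply: eq_antidiag => i m.
  rewrite fps_mul0E linear_antidiag //.
  by apply: eq_antidiag => j k; rewrite f_mu.
rewrite antidiag_interchange fps_mul0E; apply: eq_antidiag => m m'.
rewrite !fps_linE (linear_antidiag _ _ (linl _)).
by apply: eq_antidiag => a j; rewrite linear_antidiag.
Qed.

End Series.

Lemma iter_fps_lin (K : fieldType) (A : lmodType K) (f : nat -> A -> A) n :
    (forall i, linear (f i)) -> f 0%N =1 id ->
  exists g : nat -> A -> A,
    [/\ forall i, linear (g i), g 0%N =1 id
      & forall X, iter n.+1 (fps_lin f) X =1 fps_lin g X].
Proof.
move=> lin_f f0; elim: n => [|n [g [lin_g g0 gE]]]; first by exists f.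
exists (comp_coef f g); split=> [i|x|X k].
- exact: comp_coef_linear.
- by rewrite /comp_coef /antidiag big_ord1 g0 f0.
by rewrite -fps_lin_comp // iterS; apply: eq_fps_lin.
Qed.

(** * Twisting a left alternative product *)

Lemma twist_left_hom_alternative (K : fieldType) (A : lmodType K)
    (mu0 : A -> A -> A) (f : A -> A) :
    left_alternative mu0 -> linear f ->
    (forall x y, f (mu0 x y) = mu0 (f x) (f y)) ->
  left_hom_alternative (fun x y => f (mu0 x y)) f.
Proof.
move=> [[linl linr] alt] lin_f f_mul; split=> // [|x y].
  by split=> z a x y; rewrite ?linl ?linr lin_f.
by rewrite /= -!f_mul alt.
Qed.

(** Substitute [x + y] for [x] and cancel the two diagonal instances. *)
Lemma left_alternative_linearized (K : fieldType) (A : lmodType K)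
    (mu : A -> A -> A) :
    left_alternative mu ->
  forall x y z, mu x (mu y z) - mu (mu x y) z + mu y (mu x z) - mu (mu y x) z = 0.
Proof.
case=> -[linl linr] alt x y z.
have Dl u v w : mu (u + v) w = mu u w + mu v w.
  by case/linear_raddf: (linl w) => _ ->.
have Dr u v w : mu w (u + v) = mu w u + mu w v.
  by case/linear_raddf: (linr w) => _ ->.
have := alt (x + y) z; rewrite !(Dl, Dr) !alt !addrA => /addIr.
rewrite -!addrA => /addrI eq_xy.
by rewrite [X in _ + X]addrCA addrA eq_xy -opprD subrr.
Qed.

(** Multiplicativity of [G] turns each term of the deformation identity into
    [G (G X)], where [X] is a product of three constants under [mu0]; what
    remains is the linearized identity of [mu0] under an additive map.  The
    coefficients of [mut] are the composites of those of [G] with [mu0]. *)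
Lemma twist_is_deformation (K : fieldType) (A : lmodType K)
    (mu0 : A -> A -> A) (g : nat -> A -> A)
    (mut : fps A -> fps A -> fps A) (G : fps A -> fps A) :
    left_alternative mu0 ->
    (forall i, linear (g i)) -> g 0%N =1 id ->
    (forall X, G X =1 fps_lin g X) ->
    (forall X Y, G (fps_mul0 mu0 X Y) =1 fps_mul0 mu0 (G X) (G Y)) ->
    (forall X Y, mut X Y = G (fps_mul0 mu0 X Y)) ->
  is_deformation mu0 id mut G.
Proof.
move=> alt lin_g g0 GE G_mul mutE; have [bil_mu alt_mu] := alt.
have [linl linr] := bil_mu.
split; first by split.
exists (fun i x y => g i (mu0 x y)), g; split=> //.
- split=> // i; split=> [z|z] a x y.
    by rewrite linl lin_g.
  by rewrite linr lin_g.
- split=> // X Y n; rewrite mutE GE; apply: eq_bigr => i _.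
  by rewrite fps_mul0E linear_antidiag.
move=> a b c n /=.
have eqG X Y : X =1 Y -> G X =1 G Y.
  by move=> eqXY k; rewrite !GE; apply: eq_fps_lin.
(* The coefficient of [t^n] in [G (G u)], for a constant series [u]. *)
pose L u := comp_coef g g n u.
have GGE X u : X =1 fps_const u -> G (G X) n = L u.
  move=> /eqG/eqG ->; rewrite GE (eq_fps_lin _ (GE _)) fps_lin_comp //.
  by rewrite fps_lin_const //; apply: comp_coef_linear.
have mulr x y z : mut (G (fps_const x)) (mut (fps_const y) (fps_const z)) n
    = L (mu0 x (mu0 y z)).
  rewrite !mutE -(GGE (fps_mul0 mu0 (fps_const x)
    (fps_mul0 mu0 (fps_const y) (fps_const z)))); last first.
    move=> k; rewrite -fps_mul0_const //; apply: eq_fps_mul0 => //.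
    exact: fps_mul0_const.
  by apply: eqG => k; rewrite G_mul.
have mull x y z : mut (mut (fps_const x) (fps_const y)) (G (fps_const z)) n
    = L (mu0 (mu0 x y) z).
  rewrite !mutE -(GGE (fps_mul0 mu0
    (fps_mul0 mu0 (fps_const x) (fps_const y)) (fps_const z))); last first.
    move=> k; rewrite -fps_mul0_const //; apply: eq_fps_mul0 => //.
    exact: fps_mul0_const.
  by apply: eqG => k; rewrite G_mul.
have [L0 LD LB _ _] := linear_raddf (comp_coef_linear lin_g lin_g n).
by rewrite !mulr !mull /L -LB -LD -LB left_alternative_linearized.
Qed.

(** * Polynomial endomorphisms *)

Section PolynomialEndomorphism.
Variables (K : fieldType) (A : lmodType K) (p : nat).
Variable alpha : nat -> {linear A -> A}.

Lemma alpha_coef_linear i : linear (alpha_coef p alpha i).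
Proof.
move=> a x y; rewrite /alpha_coef; case: (i == 0%N) => //.
by case: (i <= p)%N; rewrite ?linearP // scaler0 addr0.
Qed.

Lemma alpha_coef_gt i x : (p < i)%N -> alpha_coef p alpha i x = 0.
Proof. by rewrite /alpha_coef; case: i => // i; rewrite ltnNge => /negPf ->. Qed.

Lemma alpha_atE t x :
  alpha_at p alpha t x = \sum_(i < p.+1) t ^+ i *: alpha_coef p alpha i x.
Proof.
rewrite /alpha_at big_ord_recl expr0 scale1r big_add1 big_mkord.
by congr (_ + _); apply: eq_bigr => i _; rewrite /alpha_coef /= ltn_ord.
Qed.

Lemma alpha_at_linear t : linear (alpha_at p alpha t).
Proof.
move=> a x y; rewrite !alpha_atE scaler_sumr -big_split; apply: eq_bigr => i _.
by rewrite alpha_coef_linear scalerDr !scalerA mulrC.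
Qed.

(** The two sides of the endomorphism identity are polynomials in [t] of degree
    at most [2p]; in characteristic zero the integers [0, ..., 2p] are enough
    distinct points to identify their coefficients. *)
Lemma endo_coef (mu0 : A -> A -> A) :
    [pchar K] =i pred0 -> bilinear_for *:%R *:%R mu0 ->
    (forall t x y, alpha_at p alpha t (mu0 x y) =
       mu0 (alpha_at p alpha t x) (alpha_at p alpha t y)) ->
  forall n x y, alpha_coef p alpha n (mu0 x y) =
    antidiag n (fun i j => mu0 (alpha_coef p alpha i x) (alpha_coef p alpha j y)).
Proof.
move=> charK0 [linl linr] endo n x y.
have mul0l z : mu0 0 z = 0 by case/linear_raddf: (linl z).
have mul0r z : mu0 z 0 = 0 by case/linear_raddf: (linr z).
have mulZ a b u v : mu0 (a *: u) (b *: v) = (a * b) *: mu0 u v.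
  case/linear_raddf: (linl (b *: v)) => _ _ _ -> _.
  by case/linear_raddf: (linr u) => _ _ _ -> _; rewrite scalerA.
pose F i j := mu0 (alpha_coef p alpha i x) (alpha_coef p alpha j y).
have F0 i j : (p < i)%N || (p < j)%N -> F i j = 0.
  by case/orP=> lt_p; rewrite /F (alpha_coef_gt _ lt_p) ?mul0l ?mul0r.
pose c k := alpha_coef p alpha k (mu0 x y) - antidiag k F.
have c_vanish t : \sum_(k < (p + p).+1) t ^+ k *: c k = 0.
  under eq_bigr => k _ do rewrite scalerBr.
  rewrite sumrB; apply/eqP; rewrite subr_eq0; apply/eqP.
  transitivity (alpha_at p alpha t (mu0 x y)).
    rewrite alpha_atE -addSn big_split_ord /= [X in _ + X]big1 ?addr0 // => i _.
    by rewrite alpha_coef_gt ?scaler0 // ltn_addr.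
  rewrite endo !alpha_atE.
  transitivity (\sum_(i < p.+1) \sum_(j < p.+1) t ^+ (i + j) *: F i j).
    case/linear_raddf: (linl (\sum_(j < p.+1) t ^+ j *: alpha_coef p alpha j y)).
    move=> _ _ _ _ ->; apply: eq_bigr => i _.
    case/linear_raddf: (linr (t ^+ i *: alpha_coef p alpha i x)) => _ _ _ _ ->.
    by apply: eq_bigr => j _; rewrite mulZ exprD.
  rewrite -(@sum_antidiag_square _ p (fun i j => t ^+ (i + j) *: F i j)); last first.
    by move=> i j /F0 ->; rewrite scaler0.
  apply: eq_bigr => k _; rewrite /antidiag scaler_sumr; apply: eq_bigr => i _.
  by rewrite subnKC // -ltnS.
have [le_n2p|lt_2pn] := leqP n (p + p).
  apply/eqP; rewrite -subr_eq0; apply/eqP.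
  apply: (@vanishing_poly_coef _ _ (p + p).+1 (fun k => k%:R) c) => //.
  move=> k l /eqP; rewrite -subr_eq0; wlog le_lk : k l / (l <= k)%N => [wl|].
    case/orP: (leq_total l k) => [/wl//|/wl wl_kl].
    by rewrite -oppr_eq0 opprB => /wl_kl.
  rewrite -natrB // (iffLR (pcharf0P K) charK0) subn_eq0 => le_kl.
  by apply/val_inj/eqP; rewrite eqn_leq le_kl.
(* Beyond degree [2p] both sides vanish. *)
rewrite alpha_coef_gt ?(leq_ltn_trans (leq_addr p p)) //.
rewrite /antidiag big1 // => i _; apply: F0; apply: contraLR lt_2pn.
rewrite negb_or -!leqNgt => /andP[le_ip le_nip].
by rewrite -(subnKC (ltnSE (ltn_ord i))) leq_add.
Qed.

End PolynomialEndomorphism.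

Theorem proposition3p5 (K : closedFieldType) (charK0 : [pchar K] =i pred0)
    (A : lmodType K) (mu0 : A -> A -> A) (mu0_left_alt : left_alternative mu0)
    (p : nat) (alpha : nat -> {linear A -> A})
    (alpha_endo : forall (t : K) (x y : A),
       alpha_at p alpha t (mu0 x y) =
       mu0 (alpha_at p alpha t x) (alpha_at p alpha t y)) :
  let alphat : fps A -> fps A := alpha_fps p alpha in
  let mut : fps A -> fps A -> fps A :=
    fun X Y => alphat (fps_mul0 mu0 X Y) in
  [/\ forall t : K,
        left_hom_alternative (fun x y => alpha_at p alpha t (mu0 x y))
                             (alpha_at p alpha t),
      is_deformation mu0 id mut alphat
    & forall n : nat,
        is_deformation mu0 id (derived_mul n mut alphat)
                              (derived_twist n alphat)].
Proof.
move=> alphat mut; have [bil_mu _] := mu0_left_alt.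
have lin_coef := alpha_coef_linear p alpha.
have deform n : is_deformation mu0 id (derived_mul n mut alphat)
                                      (derived_twist n alphat).
  have [g [lin_g g0 gE]] := iter_fps_lin n lin_coef (fun x => erefl).
  apply: (twist_is_deformation mu0_left_alt lin_g g0 gE) => X Y; last first.
    by rewrite /derived_mul /derived_twist iterSr.
  rewrite /derived_twist; elim: n.+1 => [//|m IHm] k; rewrite !iterS.
  transitivity (alphat (fps_mul0 mu0 (iter m alphat X) (iter m alphat Y)) k).
    exact: eq_fps_lin.
  exact/fps_lin_mul/endo_coef.
split=> // [t|]; last exact: (deform 0%N).
by apply: twist_left_hom_alternative => //; apply: alpha_at_linear.
Qed.
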